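(* For each $\mu\in\{0,1,2,4,9,11\}$ there exist an integer $M>1$ with $M\equiv\mu\pmod{12}$ and positive integers $a,s$ such that $$\sum_{i=0}^{M-1}(a+i)^2=s^2.\qquad( * )$$ Furthermore, let $M>1$, $a$, $s$ be positive integers satisfying $( * )$, with $M=12m+\mu$, $m\ge 0$ an integer and $\mu\in\{0,1,2,4,9,11\}$. Then the following hold. (1) If $\mu=0$, then $M\equiv 0$ or $24\pmod{72}$, and one of the following holds: - $M\equiv 0\pmod{72}$, $m\equiv 0\pmod 6$, $s\equiv 0\pmod 6$ (no condition on $a$); - $M\equiv 24\pmod{72}$, $m\equiv 2\pmod 6$, $s\equiv 2$ or $4\pmod 6$ (no condition on $a$). (2) If $\mu=1$, then $M\equiv 1\pmod{24}$, and one of the following holds: - $m\equiv 0\pmod 6$ (no condition on $a$ or $s$); - $m\equiv 2\pmod 6$, and either $a\equiv 0\pmod 6$ and $s\equiv 2$ or $4\pmod 6$, or $a\equiv 3\pmod 6$ and $s\equiv 1$ or $5\pmod 6$; - $m\equiv 4\pmod 6$, and either $a\equiv 1\pmod 2$ and $s\equiv 3\pmod 6$, or $a\equiv 0\pmod 2$ and $s\equiv 0\pmod 6$. (3) If $\mu=2$, then $M\equiv 2\pmod{24}$, and one of the following holds: - $m\equiv 0\pmod 6$, $a\equiv 0$ or $2\pmod 3$, $s\equiv 1$ or $5\pmod 6$; - $m\equiv 2\pmod 6$, $a\equiv 1\pmod 3$, $s\equiv 3\pmod 6$; - $m\equiv 4\pmod 6$, $s\equiv 1\pmod 2$ (no condition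 on $a$). (4) If $\mu=4$, then $M\equiv 16\pmod{24}$, and one of the following holds: - $m\equiv 1\pmod 6$, $a\equiv 0\pmod 3$, $s\equiv 2$ or $4\pmod 6$; - $m\equiv 3\pmod 6$, $a\equiv 1$ or $2\pmod 3$, $s\equiv 0\pmod 6$; - $m\equiv 5\pmod 6$, $s\equiv 0\pmod 2$ (no condition on $a$). (5) If $\mu=9$, then $M\equiv 9$ or $33\pmod{72}$, and one of the following holds: - $M\equiv 9\pmod{72}$, $m\equiv 0\pmod 6$, and either $a\equiv 0\pmod 2$ and $s\equiv 0\pmod 6$, or $a\equiv 1\pmod 2$ and $s\equiv 3\pmod 6$; - $M\equiv 33\pmod{72}$, $m\equiv 2\pmod 6$, and either $a\equiv 0\pmod 2$ and $s\equiv 2$ or $4\pmod 6$, or $a\equiv 1\pmod 2$ and $s\equiv 1$ or $5\pmod 6$. (6) If $\mu=11$, then one of the following holds: - $m\equiv 0\pmod 6$, $a\equiv 0$ or $2\pmod 6$, $s\equiv 1$ or $5\pmod 6$; - $m\equiv 1\pmod 6$, and either $a\equiv 1\pmod 6$ and $s\equiv 2$ or $4\pmod 6$, or $a\equiv 3$ or $5\pmod 6$ and $s\equiv 0\pmod 6$; - $m\equiv 2\pmod 6$, $a\equiv 4\pmod 6$, $s\equiv 3\pmod 6$; - $m\equiv 3\pmod 6$, $a\equiv 3$ or $5\pmod 6$, $s\equiv 2$ or $4\pmod 6$; - $m\equiv 4\pmod 6$, and either $a\equiv 0$ or $2\pmod 6$ and $s\equiv 3\pmod 6$, or $a\equiv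 4\pmod 6$ and $s\equiv 1$ or $5\pmod 6$; - $m\equiv 5\pmod 6$, $a\equiv 1\pmod 6$, $s\equiv 0\pmod 6$. *)

(* Defs.v *)
From mathcomp Require Export all_boot.

(* Main.v *)
Require Import Defs.
From mathcomp Require Import all_boot zify.

(** The key fact is that twelve consecutive squares always add up to 2 modulo
    12.  Cutting the [12 * m + mu] squares into [m] full blocks, followed by
    [mu] leftover terms, therefore turns the equation into the congruence
      [s ^ 2 = 2 * m + \sum_(i < mu) (a + i) ^ 2  (mod 12)],
    in which the long sum has disappeared ([sum_sqrn_mod12]).  Since
    [(6 * k + r) ^ 2 = 12 * (3 * k ^ 2 + k * r) + r ^ 2], a square modulo 12
    depends only on its root modulo 6, and [2 * m] modulo 12 only on [m]
    modulo 6.  For each [mu] the congruence is thus a relation between the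
    residues of [m], [a] and [s] modulo 6 ([sum_sqrn_residues]), and every
    triple of residues that satisfies it is listed in the tables of the theorem.
    Given [mu], the conditions on [M] modulo 24 and 72 are conditions on [m]
    modulo 2 and 6.

    The existence of solutions for each [mu] is witnessed by explicit runs of
    consecutive squares. *)

Lemma sqrn_mod6 a b : a = b %[mod 6] -> a ^ 2 = b ^ 2 %[mod 12].
Proof. by rewrite -!mulnn; nia. Qed.

Lemma sum_sqrn_mod6 n a b : a = b %[mod 6] ->
  \sum_(0 <= i < n) (a + i) ^ 2 = \sum_(0 <= i < n) (b + i) ^ 2 %[mod 12].
Proof.
move=> eq_ab; rewrite -modn_summ -[in RHS]modn_summ.
congr (_ %% 12); apply: eq_bigr => i _; apply: sqrn_mod6.
by rewrite -modnDml eq_ab modnDml.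
Qed.

(** Expanding, the sum is [12 * (a ^ 2 + 11 * a) + 506], and [506 = 2] modulo
    12. *)
Lemma sum12_sqrn a : \sum_(0 <= i < 12) (a + i) ^ 2 = 2 %[mod 12].
Proof. by rewrite unlock /=; lia. Qed.

(** The blocks are peeled off from the front, so that the remaining terms are
    shifted by 12, which is invisible modulo 12. *)
Lemma sum_sqrn_mod12 m mu a :
  \sum_(0 <= i < 12 * m + mu) (a + i) ^ 2
    = 2 * m + \sum_(0 <= i < mu) (a + i) ^ 2 %[mod 12].
Proof.
elim: m a => [|m IHm] a; first by rewrite !muln0 !add0n.
rewrite mulnS -addnA (@big_cat_nat _ _ _ 12) ?leq_addr //=.
rewrite -{2}[12]add0n big_addn addKn -modnDm sum12_sqrn.
under eq_bigr => i _ do rewrite (addnC i) addnA.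
rewrite (IHm (a + 12)) modnDm mulnS -addnA -modnDmr -[in RHS]modnDmr.
congr ((_ + _) %% 12); rewrite -modnDmr -[in RHS]modnDmr.
congr ((_ + _) %% 12); apply: sum_sqrn_mod6.
by rewrite -modnDmr addn0.
Qed.

Lemma sum_sqrn_residues m mu a s :
    \sum_(0 <= i < 12 * m + mu) (a + i) ^ 2 = s ^ 2 ->
  (s %% 6) ^ 2
    = 2 * (m %% 6) + \sum_(0 <= i < mu) (a %% 6 + i) ^ 2 %[mod 12].
Proof.
move=> sum_s; have eq_m : 2 * (m %% 6) = 2 * m %[mod 12] by lia.
rewrite (sqrn_mod6 _ s) ?modn_mod // -sum_s sum_sqrn_mod12.
rewrite -[in RHS]modnDm eq_m (sum_sqrn_mod6 mu (a %% 6) a) ?modn_mod //.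
by rewrite modnDm.
Qed.

Lemma modn72_run m mu : mu < 12 -> 12 * m + mu = 12 * (m %% 6) + mu %[mod 72].
Proof. lia. Qed.

Theorem theorem5 :
  (forall mu : nat, mu \in [:: 0; 1; 2; 4; 9; 11] ->
     exists M a s : nat,
       1 < M /\ M = mu %[mod 12] /\ 0 < a /\ 0 < s /\
       \sum_(0 <= i < M) (a + i) ^ 2 = s ^ 2)
  /\
  (forall M a s m mu : nat,
     1 < M -> 0 < a -> 0 < s ->
     \sum_(0 <= i < M) (a + i) ^ 2 = s ^ 2 ->
     M = 12 * m + mu -> mu \in [:: 0; 1; 2; 4; 9; 11] ->
     (mu = 0 ->
        (M = 0 %[mod 72] \/ M = 24 %[mod 72]) /\
        ((M = 0 %[mod 72] /\ m = 0 %[mod 6] /\ s = 0 %[mod 6])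
         \/
         (M = 24 %[mod 72] /\ m = 2 %[mod 6] /\
          (s = 2 %[mod 6] \/ s = 4 %[mod 6])))) /\
     (mu = 1 ->
        M = 1 %[mod 24] /\
        (m = 0 %[mod 6]
         \/
         (m = 2 %[mod 6] /\
          ((a = 0 %[mod 6] /\ (s = 2 %[mod 6] \/ s = 4 %[mod 6])) \/
           (a = 3 %[mod 6] /\ (s = 1 %[mod 6] \/ s = 5 %[mod 6]))))
         \/
         (m = 4 %[mod 6] /\
          ((a = 1 %[mod 2] /\ s = 3 %[mod 6]) \/
           (a = 0 %[mod 2] /\ s = 0 %[mod 6]))))) /\
     (mu = 2 ->
        M = 2 %[mod 24] /\
        ((m = 0 %[mod 6] /\ (a = 0 %[mod 3] \/ a = 2 %[mod 3]) /\
          (s = 1 %[mod 6] \/ s = 5 %[mod 6]))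
         \/
         (m = 2 %[mod 6] /\ a = 1 %[mod 3] /\ s = 3 %[mod 6])
         \/
         (m = 4 %[mod 6] /\ s = 1 %[mod 2]))) /\
     (mu = 4 ->
        M = 16 %[mod 24] /\
        ((m = 1 %[mod 6] /\ a = 0 %[mod 3] /\
          (s = 2 %[mod 6] \/ s = 4 %[mod 6]))
         \/
         (m = 3 %[mod 6] /\ (a = 1 %[mod 3] \/ a = 2 %[mod 3]) /\
          s = 0 %[mod 6])
         \/
         (m = 5 %[mod 6] /\ s = 0 %[mod 2]))) /\
     (mu = 9 ->
        (M = 9 %[mod 72] \/ M = 33 %[mod 72]) /\
        ((M = 9 %[mod 72] /\ m = 0 %[mod 6] /\
          ((a = 0 %[mod 2] /\ s = 0 %[mod 6]) \/
           (a = 1 %[mod 2] /\ s = 3 %[mod 6])))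
         \/
         (M = 33 %[mod 72] /\ m = 2 %[mod 6] /\
          ((a = 0 %[mod 2] /\ (s = 2 %[mod 6] \/ s = 4 %[mod 6])) \/
           (a = 1 %[mod 2] /\ (s = 1 %[mod 6] \/ s = 5 %[mod 6])))))) /\
     (mu = 11 ->
        (m = 0 %[mod 6] /\ (a = 0 %[mod 6] \/ a = 2 %[mod 6]) /\
         (s = 1 %[mod 6] \/ s = 5 %[mod 6]))
        \/
        (m = 1 %[mod 6] /\
         ((a = 1 %[mod 6] /\ (s = 2 %[mod 6] \/ s = 4 %[mod 6])) \/
          ((a = 3 %[mod 6] \/ a = 5 %[mod 6]) /\ s = 0 %[mod 6])))
        \/
        (m = 2 %[mod 6] /\ a = 4 %[mod 6] /\ s = 3 %[mod 6])
        \/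
        (m = 3 %[mod 6] /\ (a = 3 %[mod 6] \/ a = 5 %[mod 6]) /\
         (s = 2 %[mod 6] \/ s = 4 %[mod 6]))
        \/
        (m = 4 %[mod 6] /\
         (((a = 0 %[mod 6] \/ a = 2 %[mod 6]) /\ s = 3 %[mod 6]) \/
          (a = 4 %[mod 6] /\ (s = 1 %[mod 6] \/ s = 5 %[mod 6]))))
        \/
        (m = 5 %[mod 6] /\ a = 1 %[mod 6] /\ s = 0 %[mod 6]))).
Proof.
split=> [mu|M a s m mu _ _ _ sum_s defM mu_in]; last subst M.
  rewrite !inE => /or4P[/eqP->|/eqP->|/eqP->|/or3P[]/eqP->].
  - exists 24, 1, 70; do !split=> //.
    by rewrite unlock; apply/eqP; vm_compute.
  - exists 49, 25, 357; do !split=> //.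
    by rewrite unlock; apply/eqP; vm_compute.
  - by exists 2, 3, 5; rewrite unlock.
  - exists 184, 7, 1518; do !split=> //.
    by rewrite unlock; apply/eqP; vm_compute.
  - exists 33, 7, 143; do !split=> //.
    by rewrite unlock; apply/eqP; vm_compute.
  - exists 11, 18, 77; do !split=> //.
    by rewrite unlock; apply/eqP; vm_compute.
move: sum_s => /sum_sqrn_residues.
have mu12 : mu < 12 by move: mu_in; rewrite !inE; lia.
have M72 := modn72_run m mu mu12.
(* Every residue in the goal is a function of those of [m], [a], [s]
   modulo 6. *)
rewrite -!(@modn_dvdm 72 (12 * m + mu) 24) // M72.
rewrite -!(@modn_dvdm 6 a 2) // -!(@modn_dvdm 6 a 3) // -!(@modn_dvdm 6 s 2) //.
have lt6 n : n %% 6 < 6 by exact: ltn_pmod.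
move: (lt6 m) (lt6 a) (lt6 s).
move: (m %% 6) (a %% 6) (s %% 6) => rm ra rs rm6 ra6 rs6.
move: mu_in mu12 {M72}; rewrite !inE.
case/or4P=> [/eqP->|/eqP->|/eqP->|/or3P[]/eqP->] _; rewrite unlock => res.
(* The 216 triples: those violating the congruence are discarded before the
   large conclusion is evaluated. *)
all: case: rm rm6 res => [|[|[|[|[|[|//]]]]]] _;
  case: ra ra6 => [|[|[|[|[|[|//]]]]]] _;
  case: rs rs6 => [|[|[|[|[|[|//]]]]]] _ res.
all: vm_compute in res; try discriminate res.
all: vm_compute; repeat apply: conj; move=> // _; auto 10.
Qed.
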